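(* Let $X$ be a Banach space, $1\le p\le\infty$, and $g$ a weight on $\mathbb Z^c$ satisfying (a)–(e). Then the subalgebra $\mathfrak s_{1,g}\bigl(\mathbb Z^c,\mathcal B(X)\bigr)$ is full in $\mathcal B\bigl(l_p(\mathbb Z^c,X)\bigr)$.
   Context: Weight conditions on $g:\mathbb Z^c\to(0,\infty)$: (a) $g(0)=1$; (b) $g(m+n)\le g(m)g(n)$; (c) $g(-n)=g(n)$; (d) $g\ge1$; (e) for each $t\in\mathbb Z^c$, $\sqrt[n]{g(nt)}\to1$ as $n\to\infty$. $l_{1,g}(\mathbb Z^c,\mathbb C)$: families with $\sum_m g(m)|\beta_m|<\infty$. $\mathfrak s_{1,g}(\mathbb Z^c,\mathcal B(X))$: operators $T$ on $l_p(\mathbb Z^c,X)$ of the form $(Tx)_k=\sum_{m\in\mathbb Z^c}b_{km}x_{k-m}$, $b_{km}\in\mathcal B(X)$, with $\|b_{km}\|\le\beta_m$ for all $k,m$ for some nonnegative $\beta\in l_{1,g}(\mathbb Z^c,\mathbb C)$. A unital subalgebra is full if it contains the inverses (in the ambient algebra) of its invertible elements. *)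

(* Defs.v *)
From mathcomp Require Import all_boot all_order all_algebra.
From mathcomp Require Import all_classical all_reals all_analysis.
From mathcomp Require Import complex.
Set Implicit Arguments. Unset Strict Implicit. Unset Printing Implicit Defensive.
Import Order.TTheory GRing.Theory Num.Theory ComplexField.
Import numFieldNormedType.Exports.
Local Open Scope classical_set_scope.
Local Open Scope ring_scope.

Section Defs.
Variables (R : realType) (X : completeNormedModType R[i]) (c : nat).

Notation Zc := 'rV[int]_c.

Definition nrm (x : X) : R := complex.Re `|x|.

(* weight conditions (a)-(e) (plus positivity g : Z^c -> (0,oo)) *)
Definition is_weight (g : Zc -> R) : Prop :=
  (forall m, 0 < g m) /\
  [/\ g 0 = 1,
      (forall m n, g (m + n) <= g m * g n),
      (forall n, g (- n) = g n),
      (forall n, 1 <= g n) &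
      (forall t : Zc, (fun n => g (t *+ n) `^ ((n : nat)%:R^-1)) @ \oo --> (1:R))].

Definition lpnorm (p : \bar R) (x : Zc -> X) : \bar R :=
  match p with
  | +oo%E => ereal_sup [set (nrm (x k))%:E | k in [set: Zc]]
  | (r%:E)%E => ((\esum_(k in [set: Zc]) (nrm (x k) `^ r)%:E) `^ r^-1)%E
  | -oo%E => +oo%E
  end.

Definition in_lp (p : \bar R) (x : Zc -> X) : Prop := (lpnorm p x < +oo)%E.

(* T (acting on families Z^c -> X) restricts to a bounded linear operator
   on l_p(Z^c, X), i.e. an element of B(l_p(Z^c,X)) *)
Definition lp_op (p : \bar R) (T : (Zc -> X) -> (Zc -> X)) : Prop :=
  [/\ (forall x, in_lp p x -> in_lp p (T x)),
      (forall (a : R[i]) x y, in_lp p x -> in_lp p y ->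
          T (fun k => a *: x k + y k) = (fun k => a *: T x k + T y k)) &
      (exists M : R, forall x, in_lp p x -> (lpnorm p (T x) <= M%:E * lpnorm p x)%E)].

Definition lp_inverse (p : \bar R) (T S : (Zc -> X) -> (Zc -> X)) : Prop :=
  lp_op p S /\ (forall x, in_lp p x -> S (T x) = x /\ T (S x) = x).

Definition cubept (N : nat) (j : 'rV['I_(2 * N).+1]_c) : Zc :=
  map_mx (fun i : 'I_(2 * N).+1 => (nat_of_ord i)%:Z - N%:Z) j.

(* membership of T in s_{1,g}(Z^c, B(X)):
   (T x)_k = sum_m b_km x_{k-m}, b_km in B(X), ||b_km|| <= beta_m,
   beta >= 0, sum_m g(m) beta_m < oo.  The (absolutely convergent) sum over
   Z^c is taken as the limit of the sums over the cubes [-N,N]^c. *)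
Definition in_s1g (p : \bar R) (g : Zc -> R) (T : (Zc -> X) -> (Zc -> X)) : Prop :=
  lp_op p T /\
  exists (b : Zc -> Zc -> X -> X) (beta : Zc -> R),
    [/\ (forall k m, linear (b k m)),
        (forall k m v, nrm (b k m v) <= beta m * nrm v),
        (forall m, 0 <= beta m),
        (\esum_(m in [set: Zc]) (g m * beta m)%:E < +oo)%E &
        (forall x, in_lp p x -> forall k,
           (fun N => \sum_(j : 'rV['I_(2 * N).+1]_c)
                 b k (cubept j) (x (k - cubept j))) @ \oo --> T x k)].

End Defs.

(* Main.v *)
(** A noncommutative form of Newman's proof of Wiener's lemma.  Write
    [|m|] for the l1-norm on Z^c, let [C] bound the norm of [S = T^-1] on l_p,
    and call [y] localized at [a] with constant [K] (for a weight [w >= 1] with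
    [w i <= lam^|m| w (i - m)]) when [w(. - a) y] has l_p-norm at most [K].
    Given such a [y], put [z' = S (w(. - a) y)] and [z = z' / w(. - a)], so that
    [S y = z + S (y - T z)].  The diagonals [m] of [T] inside a large cube
    contribute to [y - T z] a vector localized at [a] whose constant is small
    for [lam] near 1, as conjugation by [w(. - a)] hardly changes a band
    operator; a diagonal [m] outside the cube contributes a vector localized at
    [a + m] with constant [beta_m C K].  Iterating bounds [|S y j|] by [K] times
    an envelope of [j - a], obtained from [1 / w] by repeated convolution with a
    kernel whose g-weighted mass, multiplied by [C], is at most 1/2.
      With [w i = lam^|i|] the subexponential growth of [g] makes [g / w]
    summable, hence so is the g-weighted envelope: this bounds the diagonals of
    [S].  With [w i = lam^(n - |i|)] (truncated subtraction) the envelope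
    at 0 vanishes as [n] grows: this shows that [S] is given by its matrix, even
    for p = oo, where finitely supported families are not dense. *)

Require Import Defs.
From mathcomp Require Import all_boot all_order all_algebra.
From mathcomp Require Import all_classical all_reals all_analysis.
From mathcomp Require Import complex ring lra zify.
Import Order.TTheory GRing.Theory Num.Theory ComplexField.
Import numFieldNormedType.Exports.
Local Open Scope classical_set_scope.
Local Open Scope ring_scope.
Set Implicit Arguments.
Unset Strict Implicit.
Unset Printing Implicit Defensive.

(** * Sums over a set as bounds on finite partial sums *)

Lemma esum_le_finP (R : realType) (T : choiceType) (f : T -> R) (K : R) :
  (\esum_(k in [set: T]) (f k)%:E <= K%:E)%E <->
  forall r : seq T, uniq r -> \sum_(k <- r) f k <= K.
Proof.
split=> [le_K r ur|le_K].
  rewrite -lee_fin; apply: le_trans le_K.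
  apply: ereal_sup_ubound; exists [set` r]; first by split; [exact: finite_seq|].
  by rewrite -fsbig_seq//= sumEFin.
apply: ge_ereal_sup => _ [A [finA _] <-].
rewrite fsbig_finite//= sumEFin lee_fin.
exact/le_K/finmap.fset_uniq.
Qed.

Lemma esum_lt_pinftyP (R : realType) (T : choiceType) (f : T -> R) :
  (forall k, 0 <= f k) ->
  (\esum_(k in [set: T]) (f k)%:E < +oo)%E <->
  exists K, forall r : seq T, uniq r -> \sum_(k <- r) f k <= K.
Proof.
move=> f0; split=> [fin|[K /esum_le_finP/le_lt_trans]]; last first.
  by apply; rewrite ltry.
have e0 : (0 <= \esum_(k in [set: T]) (f k)%:E)%E.
  by apply: esum_ge0 => k _; rewrite lee_fin.
exists (fine (\esum_(k in [set: T]) (f k)%:E)%E).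
by apply/esum_le_finP; rewrite fineK// ge0_fin_numE.
Qed.

(** * The real-valued norm and bounds on l_p-norms *)

Section RealNorm.
Variables (R : realType) (X : completeNormedModType R[i]).
Implicit Types x y : X.

Lemma normE x : `|x| = (nrm x)%:C%C.
Proof. by rewrite /nrm RRe_real ?normr_real. Qed.

Lemma nrm_ge0 x : 0 <= nrm x.
Proof. by rewrite -lecR -normE normr_ge0. Qed.

Lemma nrm0 : nrm (0 : X) = 0.
Proof. by rewrite /nrm normr0. Qed.

Lemma nrmN x : nrm (- x) = nrm x.
Proof. by rewrite /nrm normrN. Qed.

Lemma nrmD x y : nrm (x + y) <= nrm x + nrm y.
Proof. by rewrite -lecR rmorphD/= -!normE ler_normD. Qed.

Lemma nrmB x y : nrm (x - y) <= nrm x + nrm y.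
Proof. by rewrite -(nrmN y) nrmD. Qed.

Lemma nrmZ (a : R) x : nrm (a%:C%C *: x) = `|a| * nrm x.
Proof.
apply: (@complexI R); rewrite rmorphM/= -!normE normrZ; congr (_ * _).
by rewrite normc_def /= expr0n addr0 sqrtr_sqr.
Qed.

Lemma nrm_sum (I : Type) (r : seq I) (P : pred I) (F : I -> X) :
  nrm (\sum_(i <- r | P i) F i) <= \sum_(i <- r | P i) nrm (F i).
Proof.
elim/big_ind2 : _ => [|x a y b xa yb|//]; first by rewrite nrm0.
by apply: le_trans (nrmD _ _) _; exact: lerD.
Qed.

Lemma nrm_cvgP (u : nat -> X) (l : X) :
  u @ \oo --> l <->
  forall e : R, 0 < e -> exists N, forall n, (N <= n)%N -> nrm (l - u n) < e.
Proof.
split=> [/cvgrPdist_lt cu e e0|cu].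
  have /cu[N _ HN] : 0 < e%:C%C :> R[i] by rewrite ltcR.
  by exists N => n Nn; have := HN _ Nn; rewrite /= normE ltcR.
(* In the order of [R[i]], [0 < e] forces [e] to have zero imaginary part, so real tolerances
   suffice. *)
apply/cvgrPdist_lt => e; rewrite ltcE /= => /andP[/eqP Ie0 e0].
have [N HN] := cu _ e0; exists N => // n /= Nn.
by rewrite normE ltcE/= Ie0 eqxx HN.
Qed.

End RealNorm.

(** * Norm bounds in l_p: Minkowski's inequality and a Fatou property *)

Section LpBound.
Variables (R : realType) (X : completeNormedModType R[i]) (c : nat).
Notation Zc := 'rV[int]_c.
Implicit Types (p : \bar R) (x y : Zc -> X).

(** Membership in the ball of radius [K], stated through finite partial sums so that estimates stay
    in [R]. The last branch is meant for [p = +oo]; [-oo] is excluded by [1 <= p] wherever it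
    matters. *)
Definition lp_le p x (K : R) : Prop :=
  match p with
  | (r%:E)%E => forall s : seq Zc, uniq s ->
                  \sum_(k <- s) nrm (x k) `^ r <= K `^ r
  | _ => forall k, nrm (x k) <= K
  end.

Lemma lpnorm_leP p x (K : R) : (1%:E <= p)%E -> 0 <= K ->
  (lpnorm p x <= K%:E)%E <-> lp_le p x K.
Proof.
case: p => [r + K0|_ K0|//] /=; [rewrite lee_fin => r1|]; last first.
  split=> [le_K k|le_K].
    by rewrite -lee_fin; apply: le_trans le_K; apply: ereal_sup_ubound; exists k.
  by apply: ge_ereal_sup => _ [k _ <-]; rewrite lee_fin.
have r0 : 0 < r by lra.
have rN0 : r != 0 by rewrite gt_eqF.
set E := (X in (X `^ _)%E).
have E0 : (0 <= E)%E by apply: esum_ge0 => k _; rewrite lee_fin powR_ge0.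
rewrite -esum_le_finP -/E; split=> le_K.
  have := @gt0_ler_poweR R r (ltW r0) (E `^ r^-1)%E K%:E.
  rewrite !in_itv/= poweR_ge0 !leey lee_fin K0 => /(_ isT isT le_K).
  by rewrite -poweRrM mulVf// poweRe1// poweR_EFin.
have := @gt0_ler_poweR R r^-1 _ E (K `^ r)%:E.
rewrite !in_itv/= E0 !leey lee_fin powR_ge0 invr_ge0 => /(_ (ltW r0) isT isT le_K).
by rewrite -powRrM mulfV// powRr1.
Qed.

Lemma lpnorm_ge0 p x : (1%:E <= p)%E -> (0 <= lpnorm p x)%E.
Proof.
case: p => [r|_|//] /= ; first by rewrite poweR_ge0.
apply: (@le_trans _ _ (nrm (x 0))%:E); first by rewrite lee_fin nrm_ge0.
by apply: ereal_sup_ubound; exists 0.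
Qed.

Lemma in_lpP p x : (1%:E <= p)%E ->
  in_lp p x <-> exists2 K, 0 <= K & lp_le p x K.
Proof.
move=> p1; split=> [fin|[K K0 /(lpnorm_leP x p1 K0)]]; last first.
  by move=> /le_lt_trans; apply; rewrite ltry.
have n0 := lpnorm_ge0 x p1.
have nf : lpnorm p x \is a fin_num by rewrite ge0_fin_numE.
exists (fine (lpnorm p x)); first exact: fine_ge0.
by apply/lpnorm_leP => //; rewrite ?fine_ge0// fineK.
Qed.

Lemma lp_le_dom p x y (a K : R) : (1%:E <= p)%E -> 0 <= a -> 0 <= K ->
  (forall k, nrm (x k) <= a * nrm (y k)) -> lp_le p y K -> lp_le p x (a * K).
Proof.
case: p => [r + a0 K0 xy|_ a0 K0 xy|//] /=; [rewrite lee_fin => r1|]; last first.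
  by move=> yK k; apply: le_trans (xy k) _; exact: ler_wpM2l.
move=> yK s us; rewrite powRM//.
apply: le_trans (ler_wpM2l (powR_ge0 _ _) (yK _ us)).
rewrite mulr_sumr; apply: ler_sum => k _; rewrite -powRM ?nrm_ge0//.
apply: ge0_ler_powR => //; first lra; rewrite nnegrE ?nrm_ge0//.
by rewrite mulr_ge0// nrm_ge0.
Qed.

Lemma lp_le_weak p x (K L : R) : (1%:E <= p)%E -> 0 <= K -> K <= L ->
  lp_le p x K -> lp_le p x L.
Proof.
move=> p1 K0 KL; case: p p1 => [r|_|//] /=; [rewrite lee_fin => r1|]; last first.
  by move=> xK k; exact: le_trans (xK k) _.
move=> xK s us; apply: le_trans (xK _ us) _.
apply: ge0_ler_powR => //; first lra; rewrite nnegrE//; lra.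
Qed.

Lemma lp_le_pt p x (K : R) : (1%:E <= p)%E -> 0 <= K -> lp_le p x K ->
  forall k, nrm (x k) <= K.
Proof.
case: p => [r + K0 xK k|_ _|//] //=; rewrite lee_fin => r1.
have := xK [:: k] isT; rewrite big_seq1 => le_r.
have r0 : 0 < r by lra.
rewrite leNgt; apply/negP => lt_K.
have := @gt0_ltr_powR R r r0 K (nrm (x k)).
by rewrite !nnegrE nrm_ge0 K0 => /(_ isT isT lt_K); rewrite ltNge le_r.
Qed.

Lemma lp_le_shift p x (K : R) (m : Zc) :
  lp_le p x K -> lp_le p (fun k => x (k - m)) K.
Proof.
case: p => [r||] /= xK; try by move=> k; exact: xK.
move=> s us; rewrite -(big_map (fun k => k - m) xpredT (fun k => nrm (x k) `^ r)).
by apply: xK; rewrite map_inj_uniq//; exact: addIr.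
Qed.

Lemma lp_le_delta p (a : Zc) (v : X) : (1%:E <= p)%E ->
  lp_le p (fun k => if k == a then v else 0) (nrm v).
Proof.
case: p => [r|_|//] /=; [rewrite lee_fin => r1|]; last first.
  by move=> k; case: eqP => // _; rewrite nrm0 nrm_ge0.
move=> s us; have r0 : r != 0 by rewrite gt_eqF//; lra.
under eq_bigr => k _.
  have -> : nrm (if k == a then v else 0) `^ r = if k == a then nrm v `^ r else 0.
    by case: eqP => // _; rewrite nrm0 powR0.
  over.
rewrite -big_mkcond/=; have [as_|as_] := boolP (a \in s).
  rewrite -big_filter -(_ : [:: a] = [seq k <- s | k == a]) ?big_seq1//.
  by rewrite filter_pred1_uniq.
rewrite big_seq_cond big_pred0 ?powR_ge0// => k.
by case: eqP => [->|]; rewrite ?andbF// (negbTE as_).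
Qed.

(** Minkowski's inequality by convexity of the power [r]: [(x + y) / (K + L)] is the convex
    combination of [x / K] and [y / L] with weight [t = K / (K + L)]. If [K] or [L] is 0, the
    corresponding family vanishes, so these cases are settled before dividing. *)
Lemma lp_le_add p x y (K L : R) : (1%:E <= p)%E -> 0 <= K -> 0 <= L ->
  lp_le p x K -> lp_le p y L -> lp_le p (fun k => x k + y k) (K + L).
Proof.
move=> p1 K0 L0 xK yL.
have [KE|KN0] := eqVneq K 0.
  suff -> : (fun k => x k + y k) = y by rewrite KE add0r.
  apply/funext => k; have := lp_le_pt p1 K0 xK k; rewrite KE => xk0.
  have /eqP : nrm (x k) = 0 by apply/le_anti; rewrite xk0 nrm_ge0.
  by rewrite -(inj_eq (@complexI R)) -normE normr_eq0 => /eqP->; rewrite add0r.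
have [LE|LN0] := eqVneq L 0.
  suff -> : (fun k => x k + y k) = x by rewrite LE addr0.
  apply/funext => k; have := lp_le_pt p1 L0 yL k; rewrite LE => yk0.
  have /eqP : nrm (y k) = 0 by apply/le_anti; rewrite yk0 nrm_ge0.
  by rewrite -(inj_eq (@complexI R)) -normE normr_eq0 => /eqP->; rewrite addr0.
have {KN0}K0 : 0 < K by rewrite lt_def KN0.
have {LN0}L0 : 0 < L by rewrite lt_def LN0.
case: p p1 xK yL => [r + xK yL|_ xK yL|//] /=; [rewrite lee_fin => r1|]; last first.
  by move=> k; apply: le_trans (nrmD _ _) _; exact: lerD.
move=> s us; have KL0 : 0 < K + L by lra.
have t01 : 0 <= K / (K + L) <= 1.
  apply/andP; split; first by apply: divr_ge0; lra.
  by rewrite ler_pdivrMr// mul1r; lra.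
set t := K / (K + L) in t01.
have tE : 1 - t = L / (K + L) by rewrite /t; field; rewrite gt_eqF.
have pt k : nrm (x k + y k) `^ r <=
    (K + L) `^ r * (t * ((K `^ r)^-1 * nrm (x k) `^ r) +
                    (1 - t) * ((L `^ r)^-1 * nrm (y k) `^ r)).
  have [t0 t1] := andP t01.
  have := convex_powR r1 (Itv01 t0 t1) (x := nrm (x k) / K) (y := nrm (y k) / L).
  have x0 : 0 <= nrm (x k) / K by rewrite divr_ge0 ?nrm_ge0 ?ltW.
  have y0 : 0 <= nrm (y k) / L by rewrite divr_ge0 ?nrm_ge0 ?ltW.
  rewrite !inE/= !in_itv/= !andbT x0 y0 => /(_ isT isT).
  rewrite !convRE/= /unstable.onem => cvx.
  have {}cvx : (t * (nrm (x k) / K) + (1 - t) * (nrm (y k) / L)) `^ r <=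
      t * (nrm (x k) / K) `^ r + (1 - t) * (nrm (y k) / L) `^ r by exact: cvx.
  have e1 : (nrm (x k) / K) `^ r = (K `^ r)^-1 * nrm (x k) `^ r.
    by rewrite mulrC powRM ?invr_ge0 ?nrm_ge0 ?ltW// -powR_inv1 ?ltW// powRAC powR_inv1 ?powR_ge0.
  have e2 : (nrm (y k) / L) `^ r = (L `^ r)^-1 * nrm (y k) `^ r.
    by rewrite mulrC powRM ?invr_ge0 ?nrm_ge0 ?ltW// -powR_inv1 ?ltW// powRAC powR_inv1 ?powR_ge0.
  rewrite e1 e2 in cvx.
  apply: le_trans (ler_wpM2l (powR_ge0 _ _) cvx).
  have t'0 : 0 <= 1 - t by lra.
  have a0 : 0 <= t * (nrm (x k) / K) + (1 - t) * (nrm (y k) / L).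
    by rewrite addr_ge0// mulr_ge0.
  rewrite -powRM ?(ltW KL0)//; apply: ge0_ler_powR; first lra.
  - by rewrite nnegrE nrm_ge0.
  - by rewrite nnegrE mulr_ge0// ltW.
  rewrite tE /t; apply: le_trans (nrmD _ _) _; rewrite le_eqVlt; apply/orP; left.
  by apply/eqP; field; rewrite !gt_eqF.
apply: le_trans (ler_sum _ (fun k _ => pt k)) _.
rewrite -mulr_sumr big_split/= -!mulr_sumr -[leRHS]mulr1.
apply: ler_wpM2l; first exact: powR_ge0.
have [t0 t1] := andP t01.
rewrite [leRHS](_ : _ = t * 1 + (1 - t) * 1); last by ring.
apply: lerD; apply: ler_wpM2l; try lra.
  by rewrite ler_pdivrMl ?powR_gt0// mulr1 xK.
by rewrite ler_pdivrMl ?powR_gt0// mulr1 yL.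
Qed.

Lemma lp_le_sum p (I : eqType) (s : seq I) (F : I -> Zc -> X) (K : I -> R) :
  (1%:E <= p)%E -> (forall i, 0 <= K i) ->
  (forall i, i \in s -> lp_le p (F i) (K i)) ->
  lp_le p (fun k => \sum_(i <- s) F i k) (\sum_(i <- s) K i).
Proof.
move=> p1 K0; elim: s => [_|i s IH FK].
  rewrite big_nil -(nrm0 X) (_ : (fun k => _) = (fun k => if k == 0 then 0 else 0)).
    exact: lp_le_delta.
  by apply/funext => k; rewrite big_nil; case: eqP.
rewrite big_cons (_ : (fun k => _) = (fun k => F i k + \sum_(i <- s) F i k)).
  apply: lp_le_add => //; first exact: sumr_ge0.
    by apply: FK; rewrite inE eqxx.
  by apply: IH => j js; apply: FK; rewrite inE js orbT.
by apply/funext => k; rewrite big_cons.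
Qed.

Lemma lp_le_eps p x (K : R) : (1%:E <= p)%E -> 0 <= K ->
  (forall e, 0 < e -> lp_le p x (K + e)) -> lp_le p x K.
Proof.
move=> p1 K0 xK; apply/lpnorm_leP => //; apply/lee_addgt0Pr => e e0.
by rewrite -EFinD; apply/lpnorm_leP => //; [lra|exact: xK].
Qed.

Lemma lp_le_restrict p x (K : R) : (1%:E <= p)%E ->
  (forall s : seq Zc, uniq s -> lp_le p (fun k => if k \in s then x k else 0) K) ->
  lp_le p x K.
Proof.
case: p => [r|_|//] /= => [_ xK|xK k]; last first.
  by have := xK [:: k] isT k; rewrite inE eqxx.
move=> s us; have := xK s us s us; rewrite big_seq_cond [leRHS]/=.
by rewrite [in X in X -> _](eq_bigr (fun k => nrm (x k) `^ r)) -?big_seq_cond// => k /andP[->].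
Qed.

(** Coordinatewise limits are enough: on a finite set [s] the limit is the restriction of some [u n]
    plus one point mass per element of [s], each of norm below [e'], hence of total norm at most
    [e]. *)
Lemma lp_le_fatou p (u : nat -> Zc -> X) x (K : R) (N : nat) :
  (1%:E <= p)%E -> 0 <= K -> (forall n, (N <= n)%N -> lp_le p (u n) K) ->
  (forall k, u ^~ k @ \oo --> x k) -> lp_le p x K.
Proof.
move=> p1 K0 uK ux; apply: lp_le_restrict => // s us.
apply: lp_le_eps => // e e0.
set e' := e / (size s).+1%:R.
have e'0 : 0 < e' by rewrite divr_gt0.
have [n Nn xu] : exists2 n, (N <= n)%N & forall k, k \in s -> nrm (x k - u n k) < e'.
  suff [M HM] : exists M, forall n, (M <= n)%N -> forall k, k \in s -> nrm (x k - u n k) < e'.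
    by exists (maxn N M); [exact: leq_maxl|apply: HM; exact: leq_maxr].
  elim: s {us e' e'0} (e') (e'0) => [|a s IH] e' e'0; first by exists 0%N.
  have [M HM] := IH e' e'0; have /nrm_cvgP/(_ _ e'0)[M' HM'] := ux a.
  exists (maxn M M') => n; rewrite geq_max => /andP[Mn M'n] k.
  by rewrite inE => /orP[/eqP->|ks]; [exact: HM'|exact: HM].
rewrite (_ : (fun k => _) = (fun k => (if k \in s then u n k else 0) +
    \sum_(a <- s) if k == a then x a - u n a else 0)); last first.
  apply/funext => k; have [ks|ks] := boolP (k \in s).
    rewrite (bigD1_seq k)//= eqxx big1 ?addr0 1?addrC ?subrK// => a ak.
    by rewrite eq_sym (negbTE ak).
  rewrite big_seq big1 ?addr0// => a as_; case: eqP => // ka.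
  by rewrite ka as_ in ks.
apply: lp_le_add => //; first exact: ltW.
  rewrite -[K]mul1r; apply: lp_le_dom (uK _ Nn) => // k.
  by rewrite mul1r; case: ifP => // _; rewrite nrm0 nrm_ge0.
apply: (@lp_le_weak _ _ (\sum_(a <- s) e')) => //.
- by apply: sumr_ge0 => ? _; exact: ltW.
- rewrite big_const_seq count_predT iter_addr_0 -mulr_natr /e' -mulrA ger_pMr//.
  by rewrite mulrC ler_pdivrMr// mul1r ler_nat.
apply: lp_le_sum => // [_|a as_]; first exact: ltW.
apply: (@lp_le_weak _ _ (nrm (x a - u n a))); rewrite ?nrm_ge0//.
  exact/ltW/xu.
exact: lp_le_delta.
Qed.

End LpBound.

(** * Sums over the lattice and growth of weights *)

Lemma ler_sum_subset (R : numDomainType) (T : eqType) (s r : seq T) (f : T -> R) :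
  (forall i, 0 <= f i) -> uniq r -> uniq s -> {subset r <= s} ->
  \sum_(i <- r) f i <= \sum_(i <- s) f i.
Proof.
move=> f0 ur us rs; rewrite [leRHS](bigID (mem r))/=.
rewrite -[X in _ <= X + _]big_filter [X in _ <= X + _](perm_big r) ?lerDl ?sumr_ge0//=.
by apply: uniq_perm; rewrite ?filter_uniq// => i; rewrite mem_filter andb_idr//; exact: rs.
Qed.

Section Cubes.
Variable c : nat.
Notation Zc := 'rV[int]_c.
Implicit Types (m : Zc) (N : nat).

Definition cube N : seq Zc := [seq cubept j | j <- enum {: 'rV['I_(2 * N).+1]_c}].

Lemma big_cube (V : nmodType) N (F : Zc -> V) :
  \sum_(j : 'rV['I_(2 * N).+1]_c) F (cubept j) = \sum_(m <- cube N) F m.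
Proof. by rewrite big_map big_enum. Qed.

Lemma cube_uniq N : uniq (cube N).
Proof.
rewrite map_inj_uniq ?enum_uniq// => i j /matrixP ij.
apply/matrixP => a b; have := ij a b; rewrite !mxE => /addIr[].
exact: val_inj.
Qed.

Lemma mem_cube N m : (m \in cube N) = [forall i, (`|m ord0 i| <= N)%N].
Proof.
apply/mapP/forallP => [[j _ ->] i|mN].
  rewrite mxE; have := ltn_ord (j ord0 i); move: (nat_of_ord _) => a aN.
  lia.
exists (\row_i inord `|m ord0 i + N%:Z|); first by rewrite mem_enum.
apply/rowP => i; rewrite !mxE inordK; move: (m ord0 i) (mN i) => z zN; lia.
Qed.

Lemma cube_le N M : (N <= M)%N -> {subset cube N <= cube M}.
Proof.
move=> NM m; rewrite !mem_cube => /forallP mN; apply/forallP => i.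
exact: leq_trans (mN i) NM.
Qed.

(** The l1-norm suits product arguments: [t ^+ zlen m] factors over the coordinates of [m]. *)
Definition zlen m : nat := (\sum_i `|m ord0 i|)%N.

Lemma zlen0 : zlen 0 = 0%N.
Proof. by rewrite /zlen big1// => i _; rewrite mxE. Qed.

Lemma zlenN m : zlen (- m) = zlen m.
Proof. by apply: eq_bigr => i _; rewrite mxE abszN. Qed.

Lemma zlenD m m' : (zlen (m + m') <= zlen m + zlen m')%N.
Proof.
rewrite /zlen -big_split/=; apply: leq_sum => i _; rewrite mxE.
by move: (m ord0 i) (m' ord0 i) => a b; lia.
Qed.

Lemma zlen_cube N m : m \in cube N -> (zlen m <= c * N)%N.
Proof.
rewrite mem_cube => /forallP mN; rewrite /zlen.
apply: leq_trans (leq_sum _ (fun i _ => mN i)) _.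
by rewrite sum_nat_const card_ord.
Qed.

Lemma cube_zlen m : m \in cube (zlen m).
Proof.
rewrite mem_cube; apply/forallP => i; rewrite /zlen (bigD1 i)//=; exact: leq_addr.
Qed.

Lemma seq_sub_cube (s : seq Zc) : exists N, {subset s <= cube N}.
Proof.
exists (\max_(m <- s) zlen m)%N => m ms.
by apply: cube_le (cube_zlen m); exact: leq_bigmax_seq.
Qed.

Variable R : realType.

Lemma geometric_partial_le (t : R) n : 0 < t < 1 ->
  \sum_(i < n) t ^+ i <= (1 - t)^-1.
Proof.
move=> /andP[t0 t1]; have d0 : 0 < 1 - t by lra.
rewrite -[leRHS]mul1r ler_pdivlMr// mulrC -opprB mulNr -subrX1 opprB.
by rewrite gerBl exprn_ge0// ltW.
Qed.

Lemma sum_exp_dist_le (t : R) N : 0 < t < 1 ->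
  \sum_(i < (2 * N).+1) t ^+ `|(i : nat)%:Z - N%:Z|%N <= 2 * (1 - t)^-1.
Proof.
move=> t01.
rewrite -(big_mkord xpredT (fun i => t ^+ `|i%:Z - N%:Z|%N)).
rewrite (@big_cat_nat _ _ _ N)//=; last by lia.
rewrite mulr_natl mulr2n; apply: lerD.
  (* Reversed, the half below [N] has the exponents 1 to [N]: a geometric sum of [N.+1] terms
     without its first one. *)
  rewrite big_nat_rev/= big_mkord.
  apply: le_trans (geometric_partial_le N.+1 t01).
  rewrite [leRHS]big_ord_recl/= -[leLHS]add0r; apply: lerD; first by rewrite expr0.
  apply: ler_sum => i _; rewrite le_eqVlt; apply/orP; left; apply/eqP.
  by congr (_ ^+ _); have := ltn_ord i; rewrite /bump /=; lia.
rewrite -{1}[N]add0n big_addn big_mkord.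
apply: le_trans (geometric_partial_le ((2 * N).+1 - N) t01).
apply: ler_sum => i _; rewrite le_eqVlt; apply/orP; left; apply/eqP.
by congr (_ ^+ _); lia.
Qed.

(** Over a cube the sum factors into [c] equal one-dimensional sums, each bounded independently of
    [N]. *)
Lemma sum_exp_zlen_bounded (t : R) : 0 < t < 1 ->
  exists B, forall r : seq Zc, uniq r -> \sum_(m <- r) t ^+ zlen m <= B.
Proof.
move=> t01; have t0 : 0 <= t by move: t01; lra.
exists ((2 * (1 - t)^-1) ^+ c) => r ur.
have [N rN] := seq_sub_cube r.
apply: le_trans (ler_sum_subset _ ur (cube_uniq N) rN) _ => [m|]; first exact: exprn_ge0.
rewrite -big_cube (reindex (fun f : {ffun 'I_c -> 'I_(2 * N).+1} => \row_i f i))/=; last first.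
  exists (fun j : 'rV__ => [ffun i => j ord0 i]) => [f _|j _].
    by apply/ffunP => i; rewrite ffunE mxE.
  by apply/rowP => i; rewrite mxE ffunE.
rewrite (eq_bigr (fun f : {ffun 'I_c -> 'I_(2 * N).+1} =>
    \prod_i t ^+ `|(f i : nat)%:Z - N%:Z|%N)); last first.
  move=> f _; rewrite /zlen expr_sum; apply: eq_bigr => i _.
  by rewrite !mxE.
rewrite -(bigA_distr_bigA (fun (_ : 'I_c) (a : 'I_(2 * N).+1) => t ^+ `|(a : nat)%:Z - N%:Z|%N)).
apply: le_trans (_ : \prod_(i < c) (2 * (1 - t)^-1) <= _); last first.
  by rewrite prodr_const card_ord.
apply: ler_prod => i _; rewrite sum_exp_dist_le// andbT.
by apply: sumr_ge0 => a _; exact: exprn_ge0.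
Qed.

(** Take a finite [r0] whose sum is within [e] of the supremum, and a cube containing it. A list
    outside the cube is disjoint from [r0], so it can add at most [e]. *)
Lemma cube_tail_small (f : Zc -> R) (K : R) : (forall m, 0 <= f m) ->
  (forall r : seq Zc, uniq r -> \sum_(m <- r) f m <= K) ->
  forall e, 0 < e -> exists N, forall r : seq Zc, uniq r ->
    (forall m, m \in r -> m \notin cube N) -> \sum_(m <- r) f m <= e.
Proof.
move=> f0 fK e e0.
pose A := [set a : R | exists2 r : seq Zc, uniq r & a = \sum_(m <- r) f m].
have supA : has_sup A.
  split; first by exists 0, [::] => //; rewrite big_nil.
  by exists K => _ [r ur ->]; exact: fK.
have [_ [r0 ur0 ->] lt_r0] := sup_adherent e0 supA.
have [N r0N] := seq_sub_cube r0; exists N => r ur rN.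
have : \sum_(m <- r0 ++ r) f m <= sup A.
  apply: sup_upper_bound => //; exists (r0 ++ r) => //.
  rewrite cat_uniq ur0 ur andbT/=; apply/hasPn => m mr; apply/negP => /r0N.
  by rewrite (negbTE (rN _ mr)).
by rewrite big_cat/=; lra.
Qed.

(** By condition (e), the n-th root of [g (t *+ n)] is eventually at most [mu]; the finitely many
    earlier values are absorbed into [K]. *)
Lemma weight_line_subexp (g : Zc -> R) (mu : R) (t : Zc) : is_weight g -> 1 < mu ->
  exists2 K, 0 <= K & forall n, g (t *+ n) <= K * mu ^+ n.
Proof.
move=> [gpos [_ _ _ g1 grs]] mu1.
have /cvgrPdist_lt/(_ (mu - 1))[|N _ HN] := grs t; first by lra.
(* The strict inequality excludes [n = 0], where the exponent [n%:R^-1] is 0 and the root cannot be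
   undone. *)
have HN' n : (N < n)%N -> g (t *+ n) <= mu ^+ n.
  move=> Nn; have /ltW := HN n (ltnW Nn); rewrite /= distrC ler_norml => /andP[_].
  rewrite lerD2r => le_mu.
  have n0 : n%:R != 0 :> R by rewrite pnatr_eq0; lia.
  have := @ge0_ler_powR R n%:R (ler0n _ _) _ mu _ _ le_mu.
  rewrite !nnegrE powR_ge0 -powRrM mulVf// powRr1 ?(ltW (gpos _))//.
  by rewrite powR_mulrn; [apply => //; lra|lra].
have s0 : 0 <= \sum_(i < N.+1) g (t *+ i) by apply: sumr_ge0 => i _; exact: ltW.
exists (1 + \sum_(i < N.+1) g (t *+ i)); first lra.
move=> n; have e1 : 1 <= mu ^+ n by rewrite exprn_ege1// ltW.
have [Nn|nN] := ltnP N n.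
  by apply: le_trans (HN' _ Nn) _; rewrite ler_peMl//; lra.
apply: (@le_trans _ _ (1 + \sum_(i < N.+1) g (t *+ i))); last by rewrite ler_peMr//; lra.
have nN' : (n < N.+1)%N by [].
rewrite (bigD1 (Ordinal nN'))//= addrCA lerDl addr_ge0//.
by apply: sumr_ge0 => i _; exact: ltW.
Qed.

(** Decompose [m] along the coordinate axes and use submultiplicativity; the symmetry of [g] handles
    negative coordinates. *)
Lemma weight_subexp (g : Zc -> R) (mu : R) : is_weight g -> 1 < mu ->
  exists2 K, 0 <= K & forall m, g m <= K * mu ^+ zlen m.
Proof.
move=> wg mu1; have [gpos [g0 gD gN g1 _]] := wg.
have /choice[K HK] (i : 'I_c) : exists K, 0 <= K /\
    forall z : int, g ((delta_mx ord0 i : Zc) *~ z) <= K * mu ^+ `|z|%N.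
  have [K K0 HK] := weight_line_subexp (delta_mx ord0 i) wg mu1.
  exists K; split=> // -[n|n]; first exact: HK.
  by rewrite NegzE mulrNz gN abszN; exact: HK.
exists (\prod_i K i) => [|m]; first by apply: prodr_ge0 => i _; case: (HK i).
have {1}-> : m = \sum_i (delta_mx ord0 i : Zc) *~ m ord0 i.
  rewrite {1}[m]row_sum_delta; apply: eq_bigr => i _.
  by apply/rowP => j; rewrite -scaler_int intz.
apply: (@le_trans _ _ (\prod_i g ((delta_mx ord0 i : Zc) *~ m ord0 i))).
  elim/big_ind2 : _ => [|x a y b xa yb|//]; first by rewrite g0.
  by apply: le_trans (gD _ _) _; apply: ler_pM => //; exact: ltW.
rewrite /zlen expr_sum -big_split/=; apply: ler_prod => i _.
by rewrite ltW//=; case: (HK i).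
Qed.

(** One factor [mu ^+ zlen m] of the denominator absorbs the growth of [g]; the other leaves a
    convergent geometric sum. *)
Lemma weight_summable (g : Zc -> R) (mu : R) : is_weight g -> 1 < mu ->
  exists2 B, 0 <= B & forall r : seq Zc, uniq r ->
    \sum_(m <- r) g m / (mu ^+ 2) ^+ zlen m <= B.
Proof.
move=> wg mu1; have [K K0 HK] := weight_subexp wg mu1.
have mui : 0 < mu^-1 < 1 by rewrite invr_gt0 invf_lt1; lra.
have [B HB] := sum_exp_zlen_bounded mui.
have B0 : 0 <= B by have := HB [::] isT; rewrite big_nil.
exists (K * B) => [|r ur]; first exact: mulr_ge0.
apply: le_trans (ler_wpM2l K0 (HB r ur)); rewrite mulr_sumr; apply: ler_sum => m _.
have mu0 : 0 < mu by lra.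
have e0 : 0 < mu ^+ zlen m by rewrite exprn_gt0.
rewrite exprVn exprAC ler_pdivrMr ?exprn_gt0//.
by apply: le_trans (HK m) _; rewrite expr2 -mulrA mulKf ?gt_eqF.
Qed.

End Cubes.

(** * Decay of the inverse matrix *)

Section Envelope.
Variables (R : realType) (c : nat).
Notation Zc := 'rV[int]_c.
Variables (beta : Zc -> R) (C kap : R) (q : seq Zc).
Hypotheses (beta0 : forall m, 0 <= beta m) (C0 : 0 <= C) (kap0 : 0 <= kap).
Implicit Types (w g : Zc -> R) (d : Zc) (n : nat).

(** The localized part of the bound after [n] iterations. Its three terms come from [z], from the
    remainder still localized at [a], and from the diagonals [m] in [q], localized at [a + m]. It
    starts at 0 because the initial crude bound is put into [envelope_err]. *)
Fixpoint envelope w n d : R :=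
  if n is n'.+1 then
    C * ((w d)^-1 + kap * envelope w n' d + \sum_(m <- q) beta m * envelope w n' (d - m))
  else 0.

(** The part of the bound that is uniform in position: it starts from the norm bound [C] of [S], and
    each iteration adds [C * (C * t)] for the diagonals beyond those in [q], of total mass at most
    [t]. *)
Fixpoint envelope_err (t : R) n : R :=
  if n is n'.+1 then
    C * ((kap + \sum_(m <- q) beta m) * envelope_err t n' + C * t)
  else C.

Lemma envelope_ge0 w n d : (forall i, 1 <= w i) -> 0 <= envelope w n d.
Proof.
move=> w1; elim: n d => [//|n IH] d /=; rewrite mulr_ge0// !addr_ge0 ?mulr_ge0//.
  by rewrite invr_ge0 (le_trans _ (w1 d)).
by apply: sumr_ge0 => m _; exact: mulr_ge0.
Qed.

Lemma envelope_err_ge0 (t : R) n : 0 <= t -> 0 <= envelope_err t n.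
Proof.
move=> t0; elim: n => [//|n IH] /=; rewrite mulr_ge0// addr_ge0 ?mulr_ge0// addr_ge0//.
exact: sumr_ge0.
Qed.

(** Each iteration at least halves the error and adds [C ^+ 2 * t]; the fixed point of this
    recursion is [2 * C ^+ 2 * t]. *)
Lemma envelope_err_le (t : R) n : 0 <= t -> C * (kap + \sum_(m <- q) beta m) <= 2^-1 ->
  envelope_err t n <= C * 2^-1 ^+ n + 2 * C ^+ 2 * t.
Proof.
move=> t0 half; have C2 : 0 <= C ^+ 2 * t by rewrite mulr_ge0// exprn_ge0.
elim: n => [|n IH] /=; first by rewrite expr0 mulr1 lerDl -mulrA mulr_ge0.
rewrite mulrDr !mulrA -(expr2 C).
have := ler_pM _ (envelope_err_ge0 n t0) half IH.
rewrite mulr_ge0 ?addr_ge0 ?sumr_ge0// => /(_ isT) le1.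
apply: le_trans (lerD le1 (lexx _)) _.
rewrite [2^-1 ^+ n.+1]exprS le_eqVlt; apply/orP; left; apply/eqP.
by move: (2^-1 ^+ n) => e; field.
Qed.

(** The bound [2 * C * G] is the fixed point of [s = C * G + s / 2]. Shifting the envelope by [m]
    costs a factor [g m] in the weighted sum, by submultiplicativity, which is why [half] weights
    [beta m] by [g m]. *)
Lemma envelope_weighted_sum_le g w (G : R) n : (forall i, 1 <= w i) ->
  (forall i, 0 <= g i) -> (forall i j, g (i + j) <= g i * g j) ->
  (forall r : seq Zc, uniq r -> \sum_(d <- r) g d / w d <= G) ->
  C * (kap + \sum_(m <- q) g m * beta m) <= 2^-1 ->
  forall r : seq Zc, uniq r -> \sum_(d <- r) g d * envelope w n d <= 2 * C * G.
Proof.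
move=> w1 g0 gD gG half.
have G0 : 0 <= G by have := gG [::] isT; rewrite big_nil.
have CG0 : 0 <= C * G by exact: mulr_ge0.
elim: n => [|n IH] r ur /=.
  by rewrite big1 ?mulr0// -?mulrA ?mulr_ge0// => d _; rewrite mulr0.
apply: (@le_trans _ _ (C * (\sum_(d <- r) g d / w d +
    kap * (\sum_(d <- r) g d * envelope w n d) +
    \sum_(m <- q) g m * beta m * (\sum_(d <- [seq d - m | d <- r]) g d * envelope w n d)))).
  rewrite [in X in _ <= _ * (_ + _ + X)](eq_bigr (fun m => \sum_(d <- r)
    g m * beta m * (g (d - m) * envelope w n (d - m)))); last first.
    by move=> m _; rewrite big_map mulr_sumr.
  rewrite [in X in _ <= _ * (_ + _ + X)]exchange_big/= [in X in _ <= _ * (_ + X + _)]mulr_sumr.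
  rewrite -!big_split/= mulr_sumr; apply: ler_sum => d _.
  rewrite mulrCA; apply: ler_wpM2l => //; rewrite !mulrDr; apply: lerD.
    by rewrite mulrCA.
  rewrite mulr_sumr; apply: ler_sum => m _.
  rewrite mulrCA -[leRHS]mulrA [leRHS]mulrCA; apply: ler_wpM2l => //.
  rewrite mulrA; apply: ler_wpM2r; first exact: envelope_ge0.
  by have := gD m (d - m); rewrite addrC subrK.
have S0 : 0 <= \sum_(m <- q) g m * beta m by apply: sumr_ge0 => m _; exact: mulr_ge0.
apply: (@le_trans _ _ (C * (G + kap * (2 * C * G) +
   \sum_(m <- q) g m * beta m * (2 * C * G)))).
  apply: ler_wpM2l => //; apply: lerD; first apply: lerD; first exact: gG.
    by apply: ler_wpM2l => //; exact: IH.
  apply: ler_sum => m _; apply: ler_wpM2l; first exact: mulr_ge0.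
  by apply: IH; rewrite map_inj_uniq//; exact: addIr.
rewrite -mulr_suml -addrA -mulrDl mulrDr mulrA.
have CG2 : 0 <= 2 * C * G by rewrite -mulrA mulr_ge0.
have := ler_wpM2r CG2 half.
have -> : 2^-1 * (2 * C * G) = C * G by field.
by lra.
Qed.

Lemma envelope_cvg0 (w : nat -> Zc -> R) n :
  (forall d, (fun N => (w N d)^-1) @ \oo --> (0 : R)) ->
  forall d, (fun N => envelope (w N) n d) @ \oo --> (0 : R).
Proof.
move=> w0; elim: n => [|n IH] d /=; first exact: cvg_cst.
suff : (fun N => envelope (w N) n.+1 d) @ \oo -->
    C * (0 + kap * 0 + \sum_(m <- q) beta m * 0).
  by rewrite big1 ?mulr0 ?addr0 ?mulr0// => m _; rewrite mulr0.
apply: cvgMl_tmp; apply: cvgD.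
  apply: cvgD; first exact: w0.
  by apply: cvgMl_tmp; exact: IH.
apply: cvg_big => [|m _]; first exact: add_continuous.
by apply: cvgMl_tmp; exact: IH.
Qed.

End Envelope.

(** * Iterated estimates for the inverse operator *)

Section Iteration.
Variables (R : realType) (X : completeNormedModType R[i]) (c : nat).
Notation Zc := 'rV[int]_c.
Variables (p : \bar R) (T S : (Zc -> X) -> (Zc -> X)).
Variables (b : Zc -> Zc -> X -> X) (beta : Zc -> R) (C : R).
Implicit Types (x y : Zc -> X) (K t : R).
Hypotheses (p1 : (1%:E <= p)%E) (beta0 : forall m, 0 <= beta m) (C0 : 0 <= C).
Hypothesis b_lin : forall k m, linear (b k m).
Hypothesis b_le : forall k m v, nrm (b k m v) <= beta m * nrm v.
Hypothesis T_cvg : forall x, in_lp p x -> forall k,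
  (fun N => \sum_(m <- cube c N) b k m (x (k - m))) @ \oo --> T x k.
Hypothesis T_lp : forall x, in_lp p x -> in_lp p (T x).
Hypothesis S_lin : forall (a : R[i]) x y, in_lp p x -> in_lp p y ->
  S (fun k => a *: x k + y k) = (fun k => a *: S x k + S y k).
Hypothesis S_le : forall x (K : R), 0 <= K -> lp_le p x K -> lp_le p (S x) (C * K).
Hypothesis STK : forall x, in_lp p x -> S (T x) = x /\ T (S x) = x.

Lemma lp_le_in_lp x K : 0 <= K -> lp_le p x K -> in_lp p x.
Proof. by move=> K0 xK; apply/in_lpP => //; exists K. Qed.

Lemma in_lpD x y : in_lp p x -> in_lp p y -> in_lp p (fun k => x k + y k).
Proof.
move=> /(in_lpP _ p1)[K K0 xK] /(in_lpP _ p1)[L L0 yL].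
by apply: (@lp_le_in_lp _ (K + L)); [lra|exact: lp_le_add].
Qed.

Lemma in_lpN x : in_lp p x -> in_lp p (fun k => - x k).
Proof.
move=> /(in_lpP _ p1)[K K0 xK]; apply: (@lp_le_in_lp _ (1 * K)); first by rewrite mul1r.
by apply: lp_le_dom xK => // k; rewrite nrmN mul1r.
Qed.

Lemma in_lpB x y : in_lp p x -> in_lp p y -> in_lp p (fun k => x k - y k).
Proof. by move=> xp yp; apply: in_lpD => //; exact: in_lpN. Qed.

Lemma in_lp0 : in_lp p (fun _ : Zc => 0 : X).
Proof.
apply: (@lp_le_in_lp _ (nrm (0 : X))); first exact: nrm_ge0.
have := @lp_le_delta R X c p 0 0 p1; congr (lp_le _ _ _).
by apply/funext => k; case: eqP.
Qed.

Lemma in_lp_sum (I : eqType) (s : seq I) (F : I -> Zc -> X) :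
  (forall i, in_lp p (F i)) -> in_lp p (fun k => \sum_(i <- s) F i k).
Proof.
move=> Fp; elim: s => [|i s IH].
  by rewrite (_ : (fun k => _) = fun=> 0); [exact: in_lp0|apply/funext => k; rewrite big_nil].
rewrite (_ : (fun k => _) = fun k => F i k + \sum_(i <- s) F i k); first exact: in_lpD.
by apply/funext => k; rewrite big_cons.
Qed.

Lemma opB x y j : in_lp p x -> in_lp p y -> S (fun k => x k - y k) j = S x j - S y j.
Proof.
move=> xp yp; rewrite (_ : (fun k => _) = fun k => (-1) *: y k + x k); last first.
  by apply/funext => k; rewrite scaleN1r addrC.
by rewrite S_lin// scaleN1r addrC.
Qed.

Lemma op0 j : S (fun _ : Zc => 0) j = 0.
Proof.
rewrite -[RHS](subrr (S (fun=> 0) j)) -(opB j in_lp0 in_lp0); congr (S _ j).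
by apply/funext => k; rewrite subrr.
Qed.

Lemma opD x y j : in_lp p x -> in_lp p y -> S (fun k => x k + y k) j = S x j + S y j.
Proof.
move=> xp yp; rewrite (_ : (fun k => _) = fun k => 1 *: x k + y k); last first.
  by apply/funext => k; rewrite scale1r.
by rewrite S_lin// scale1r.
Qed.

Lemma op_sum (I : eqType) (s : seq I) (F : I -> Zc -> X) j :
  (forall i, in_lp p (F i)) ->
  S (fun k => \sum_(i <- s) F i k) j = \sum_(i <- s) S (F i) j.
Proof.
move=> Fp; elim: s => [|i s IH].
  by rewrite big_nil -[RHS](op0 j); congr (S _ j); apply/funext => k; rewrite big_nil.
rewrite big_cons -IH -opD//; last exact: in_lp_sum.
by congr (S _ j); apply/funext => k; rewrite big_cons.
Qed.

Lemma diagonalZ k m (a : R[i]) v : b k m (a *: v) = a *: b k m v.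
Proof.
have b0 : b k m 0 = 0.
  by have := b_lin k m (-1) 0 0; rewrite scaler0 add0r scaleN1r addNr.
by have := b_lin k m a v 0; rewrite b0 !addr0.
Qed.

Lemma diagonal_le x K m : 0 <= K -> lp_le p x K ->
  lp_le p (fun k => b k m (x (k - m))) (beta m * K).
Proof.
by move=> K0 xK; apply: lp_le_dom (lp_le_shift m xK) => //.
Qed.

Definition cubeD M N : seq Zc := [seq m <- cube c M | m \notin cube c N].

Lemma cubeD_uniq M N : uniq (cubeD M N).
Proof. by rewrite filter_uniq// cube_uniq. Qed.

Lemma cubeD_notin M N m : m \in cubeD M N -> m \notin cube c N.
Proof. by rewrite mem_filter => /andP[]. Qed.

Lemma sum_cubeD (V : nmodType) M N (F : Zc -> V) : (N <= M)%N ->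
  \sum_(m <- cube c M) F m = \sum_(m <- cube c N) F m + \sum_(m <- cubeD M N) F m.
Proof.
move=> NM; rewrite (bigID (mem (cube c N)))/=; congr (_ + _); last by rewrite big_filter.
rewrite -big_filter; apply: perm_big; apply: uniq_perm; rewrite ?filter_uniq ?cube_uniq// => m.
by rewrite mem_filter andb_idr//; exact: cube_le.
Qed.

Definition tail_le N (t : R) := forall r : seq Zc, uniq r ->
  (forall m, m \in r -> m \notin cube c N) -> \sum_(m <- r) beta m <= t.

Lemma tail_le_ge0 N (t : R) : tail_le N t -> 0 <= t.
Proof. by move=> /(_ [::] isT); rewrite big_nil; apply. Qed.

(** The triangle inequality bounds the difference of two cube sums by the mass of [beta] between the
    cubes; [lp_le_fatou] carries the bound to the limit, which is only coordinatewise. *)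
Lemma op_tail_le x K N t : 0 <= K -> lp_le p x K -> tail_le N t ->
  lp_le p (fun k => T x k - \sum_(m <- cube c N) b k m (x (k - m))) (t * K).
Proof.
move=> K0 xK tN; have t0 := tail_le_ge0 tN.
apply: (@lp_le_fatou _ _ _ p (fun n k => \sum_(m <- cube c n) b k m (x (k - m)) -
   \sum_(m <- cube c N) b k m (x (k - m))) _ _ N) => //; first exact: mulr_ge0.
- move=> n Nn; rewrite (_ : (fun k => _) = fun k => \sum_(m <- cubeD n N) b k m (x (k - m))).
    apply: (@lp_le_weak _ _ _ _ _ (\sum_(m <- cubeD n N) beta m * K)) => //.
    + by apply: sumr_ge0 => m _; exact: mulr_ge0.
    + rewrite -mulr_suml; apply: ler_wpM2r => //; apply: tN; first exact: cubeD_uniq.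
      by move=> m; exact: cubeD_notin.
    apply: lp_le_sum => // [m|m _]; first exact: mulr_ge0.
    exact: diagonal_le.
  by apply/funext => k; rewrite (sum_cubeD _ Nn) addrAC subrr add0r.
- move=> k; apply: cvgB; last exact: cvg_cst.
  by apply: T_cvg; exact: lp_le_in_lp xK.
Qed.

Section Weighted.
Variables (w : Zc -> R) (lam : R).
Hypotheses (w1 : forall i, 1 <= w i).
Hypothesis w_lip : forall i m, w i <= lam ^+ zlen m * w (i - m).

(** Applying [w_lip] in both directions puts the ratio between [1 / L] and [L], where
    [L = lam ^+ zlen m], and [1 - 1 / L <= L - 1]. *)
Lemma weight_ratio_le i m : `|1 - w i / w (i - m)| <= lam ^+ zlen m - 1.
Proof.
have a1 := w1 i; have a2 := w1 (i - m).
have := w_lip i m; have := w_lip (i - m) (- m); rewrite opprK subrK zlenN.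
have a0 : 0 < w (i - m) by lra.
rewrite -!ler_pdivrMr//; last by lra.
move: (lam ^+ _) => L h1 h2.
set r := w i / w (i - m) in h2 *.
have r0 : 0 < r by rewrite divr_gt0//; lra.
have h1' : r^-1 <= L by rewrite /r invf_div.
have h3 : 1 <= L * r by rewrite -ler_pdivrMr// div1r.
have L1 : 1 <= L by rewrite leNgt; apply/negP => L1; nra.
by rewrite ler_norml; apply/andP; split; nra.
Qed.

Local Notation wt a y := (fun k => (w (k - a))%:C%C *: y k).

Variables (N M : nat) (tN tM : R).
Hypotheses (NM : (N <= M)%N) (tailN : tail_le N tN) (tailM : tail_le M tM).
(** The cost of replacing [y] by [u] in [inverse_step]: the error of conjugating the diagonals in
    [cube c N] by the weight, plus the mass of all other diagonals. *)
Let kap := \sum_(m <- cube c N) beta m * (lam ^+ zlen m - 1) + tN.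

Lemma wt_le_lp a y K : 0 <= K -> lp_le p (wt a y) K -> lp_le p y K.
Proof.
move=> K0 yK; rewrite -[K]mul1r; apply: lp_le_dom yK => // k; rewrite mul1r nrmZ.
rewrite ger0_norm; last by have := w1 (k - a); lra.
by rewrite ler_peMl ?nrm_ge0.
Qed.

(** The hypothesis is quantified over [a] because it is applied at [a] to the remainder [u] and at
    [a + m] to the diagonals [Q m]. The tail [e] beyond [cube c M] is bounded through the norm of
    [S] alone, which yields the term in [tM]. *)
Lemma inverse_step (A : Zc -> R) (E : R) :
  (forall a y K, 0 <= K -> lp_le p (wt a y) K ->
     forall j, nrm (S y j) <= K * (A (j - a) + E)) ->
  forall a y K, 0 <= K -> lp_le p (wt a y) K -> forall j, nrm (S y j) <=
    K * (C * ((w (j - a))^-1 + kap * A (j - a) +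
              \sum_(m <- cubeD M N) beta m * A (j - a - m)) +
         C * ((kap + \sum_(m <- cubeD M N) beta m) * E + C * tM)).
Proof.
move=> IH a y K K0 yK j.
pose z' := S (wt a y).
pose z := fun k => ((w (k - a))^-1)%:C%C *: z' k.
have CK0 : 0 <= C * K by exact: mulr_ge0.
have z'K : lp_le p z' (C * K) by exact: S_le.
have Tz' : T z' = wt a y by apply: (STK (lp_le_in_lp K0 yK)).2.
have wp k : 0 < w (k - a) by have := w1 (k - a); lra.
have zwz k : (w (k - a))%:C%C *: z k = z' k.
  by rewrite scalerA -rmorphM/= mulfV ?gt_eqF// scale1r.
have nz k : nrm (z k) = (w (k - a))^-1 * nrm (z' k).
  by rewrite nrmZ ger0_norm// invr_ge0 ltW.
have wzK : lp_le p (wt a z) (C * K).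
  by rewrite (_ : wt a z = z')//; apply/funext => k; exact: zwz.
have zK := wt_le_lp CK0 wzK.
have zp := lp_le_in_lp CK0 zK.
pose Q m := fun k => b k m (z (k - m)).
have Qp m : in_lp p (Q m).
  by apply: lp_le_in_lp (diagonal_le m CK0 zK); exact: mulr_ge0.
pose u := fun k => y k - \sum_(m <- cube c N) Q m k.
pose e := fun k => T z k - \sum_(m <- cube c M) Q m k.
have tN0 := tail_le_ge0 tailN.
have tM0 := tail_le_ge0 tailM.
have lam1 m : 0 <= beta m * (lam ^+ zlen m - 1).
  by rewrite mulr_ge0//; apply: le_trans (weight_ratio_le 0 m).
have kap0 : 0 <= kap by rewrite addr_ge0// sumr_ge0.
(* Since [T z' = wt a y], the weighted [u] splits into commutators of the weight with the near
   diagonals and the tail of [T z']. *)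
have uK : lp_le p (wt a u) (kap * (C * K)).
  rewrite /kap mulrDl; rewrite (_ : wt a u = fun k =>
     (\sum_(m <- cube c N) (1 - w (k - a) / w (k - m - a))%:C%C *: b k m (z' (k - m))) +
     (T z' k - \sum_(m <- cube c N) b k m (z' (k - m)))); last first.
    apply/funext => k; rewrite Tz' /u scalerBr scaler_sumr addrCA; congr (_ + _).
    rewrite -sumrN -sumrN -big_split/=; apply: eq_bigr => m _.
    rewrite /Q /z diagonalZ scalerA -rmorphM/= rmorphB/= scalerBl rmorph1 scale1r.
    by rewrite [RHS]addrAC subrr add0r.
  apply: lp_le_add => //; [|exact: mulr_ge0| |exact: op_tail_le].
    by rewrite mulr_ge0// sumr_ge0.
  rewrite mulr_suml; apply: lp_le_sum => // [m|m _]; first exact: mulr_ge0.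
  rewrite (_ : _ * _ * _ = (lam ^+ zlen m - 1) * (beta m * (C * K))); last by ring.
  apply: lp_le_dom (diagonal_le m CK0 z'K) => //.
  - exact: le_trans (weight_ratio_le 0 m).
  - exact: mulr_ge0.
  move=> k; rewrite nrmZ; apply: ler_wpM2r; first exact: nrm_ge0.
  by rewrite (addrAC k); exact: weight_ratio_le.
(* Recentred at [a + m], the weight at [k] is exactly the one by which [z' (k - m)] was divided, so
   the two cancel. *)
have QK m : lp_le p (wt (a + m) (Q m)) (beta m * (C * K)).
  apply: lp_le_dom (lp_le_shift m z'K) => // k.
  have wE : w (k - (a + m)) = w (k - m - a) by rewrite opprD addrA addrAC.
  rewrite nrmZ wE ger0_norm; last exact: ltW.
  apply: le_trans (ler_wpM2l (ltW (wp _)) (b_le _ _ _)) _.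
  by rewrite nz mulrCA mulVKf// gt_eqF.
have eK : lp_le p e (tM * (C * K)) by exact: op_tail_le.
have up : in_lp p u by apply: lp_le_in_lp (wt_le_lp _ uK); exact: mulr_ge0.
have ep : in_lp p e by apply: lp_le_in_lp eK; exact: mulr_ge0.
(* Apply [S] to [y = T z + u - \sum_m Q m - e], with [m] over [cubeD M N], and use [S (T z) = z]. *)
have -> : S y j = z j + S u j - \sum_(m <- cubeD M N) S (Q m) j - S e j.
  have Sp := in_lp_sum (cubeD M N) Qp.
  have Tzp := T_lp zp.
  have {1}-> : y = fun k => (T z k + u k) - \sum_(m <- cubeD M N) Q m k - e k.
    apply/funext => k; rewrite /e /u (sum_cubeD _ NM).
    move: (\sum_(m <- cube c N) _) (\sum_(m <- cubeD M N) _) (T z k) => s1 s2 t.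
    rewrite opprB addrA (addrC s1) [_ + (s2 + s1)]addrA subrK -[t + _ + s1]addrA subrK.
    by rewrite addrAC subrr add0r.
  rewrite opB//; last by apply: in_lpB => //; exact: in_lpD.
  rewrite opB//; last exact: in_lpD.
  by rewrite opD// op_sum// (STK zp).1.
apply: le_trans (nrmB _ _) _.
apply: le_trans (lerD (nrmB _ _) (lexx _)) _.
apply: le_trans (lerD (lerD (nrmD _ _) (nrm_sum _ _ _)) (lexx _)) _.
have l1 : nrm (z j) <= C * K * (w (j - a))^-1.
  rewrite nz mulrC; apply: ler_wpM2r; first by rewrite invr_ge0 ltW.
  exact: lp_le_pt z'K j.
have l2 := IH a u _ (mulr_ge0 kap0 CK0) uK j.
have l3 : \sum_(m <- cubeD M N) nrm (S (Q m) j) <=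
    C * K * (\sum_(m <- cubeD M N) beta m * A (j - a - m)) +
    C * K * ((\sum_(m <- cubeD M N) beta m) * E).
  rewrite mulr_suml !mulr_sumr -big_split/=; apply: ler_sum => m _.
  have := IH _ _ _ (mulr_ge0 (beta0 m) CK0) (QK m) j.
  by rewrite opprD addrA => /le_trans; apply; rewrite le_eqVlt; apply/orP; left; apply/eqP; ring.
have l4 : nrm (S e j) <= C * (tM * (C * K)).
  have tCK0 : 0 <= tM * (C * K) by exact: mulr_ge0.
  by apply: (lp_le_pt p1 _ (S_le tCK0 eK)); exact: mulr_ge0.
apply: le_trans (lerD (lerD (lerD l1 l2) l3) l4) _.
by rewrite le_eqVlt; apply/orP; left; apply/eqP; ring.
Qed.

Lemma inverse_envelope n a y K : 0 <= K -> lp_le p (wt a y) K -> forall j,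
  nrm (S y j) <= K * (envelope beta C kap (cubeD M N) w n (j - a) +
                      envelope_err beta C kap (cubeD M N) tM n).
Proof.
elim: n a y K => [|n IH] a y K K0 yK j /=; last exact: inverse_step.
rewrite add0r mulrC.
by apply: (lp_le_pt p1 _ (S_le K0 (wt_le_lp K0 yK))); exact: mulr_ge0.
Qed.

End Weighted.

(** * The matrix of the inverse: summability and representation *)

Lemma tail_le_sub N M t : (N <= M)%N -> tail_le N t -> tail_le M t.
Proof.
move=> NM tN r ur rM; apply: tN => // m mr.
by apply: contra (rM m mr); exact: cube_le.
Qed.

Definition delta (a : Zc) (v : X) : Zc -> X := fun k => if k == a then v else 0.

Lemma in_lp_delta a v : in_lp p (delta a v).
Proof. by apply: lp_le_in_lp (lp_le_delta a v p1); exact: nrm_ge0. Qed.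

Definition inv_diag (k m : Zc) (v : X) : X := S (delta (k - m) v) k.

Lemma inv_diag_linear k m : linear (inv_diag k m).
Proof.
move=> a u v; rewrite /inv_diag -[RHS]/((fun j => a *: S (delta (k - m) u) j +
  S (delta (k - m) v) j) k) -S_lin; try exact: in_lp_delta.
congr (S _ k); apply/funext => j; rewrite /delta.
by case: eqP => // _; rewrite scaler0 addr0.
Qed.

Section Decay.
Variables (g : Zc -> R) (mu tN : R) (N : nat) (G : R).
Hypotheses (g_weight : is_weight g) (mu1 : 1 < mu) (tailN : tail_le N tN).
Let lam := mu ^+ 2.
Let kap := \sum_(m <- cube c N) beta m * (lam ^+ zlen m - 1) + tN.
Hypothesis small : forall M, C * (kap + \sum_(m <- cubeD M N) g m * beta m) <= 2^-1.
Hypothesis tail0 : forall t, 0 < t -> exists M, tail_le M t.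
Hypothesis g_sum : forall r : seq Zc, uniq r ->
  \sum_(m <- r) g m / lam ^+ zlen m <= G.

Let lam1 : 1 <= lam.
Proof. by rewrite exprn_ege1// ltW. Qed.

Let lamX n : 1 <= lam ^+ n.
Proof. exact: exprn_ege1. Qed.

Let kap0 : 0 <= kap.
Proof.
rewrite addr_ge0 ?(tail_le_ge0 tailN)// sumr_ge0// => m _.
by rewrite mulr_ge0// subr_ge0.
Qed.

(** The smallness hypothesis is uniform in [M], so the tail mass [t], hence [M], and the number [n]
    of iterations can be chosen separately, each costing at most [e / 2]. *)
Lemma envelope_err_small e : 0 < e -> exists n M t, [/\ (N <= M)%N, tail_le M t &
  envelope_err beta C kap (cubeD M N) t n <= e].
Proof.
move=> e0; have C2 : 0 <= C ^+ 2 by exact: exprn_ge0.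
set t := e / (4 * (C ^+ 2 + 1)).
have t0 : 0 < t by rewrite divr_gt0//; lra.
have [M0 HM0] := tail0 t0.
have [n Hn] : exists n, C * 2^-1 ^+ n <= e / 2.
  have := @cvg_geometric R C 2^-1 _; rewrite ger0_norm ?invr_ge0//.
  rewrite invf_lt1 ?ltr1n// => /(_ isT)/cvgrPdist_le/(_ (e / 2)).
  move=> /(_ ltac:(lra))[n _ Hn]; exists n.
  have := Hn n (leqnn n); rewrite /= /geometric /= sub0r normrN.
  by apply: le_trans; exact: ler_norm.
have NM := leq_maxl N M0.
exists n, (maxn N M0), t; split=> //; first exact: tail_le_sub (leq_maxr _ _) HM0.
apply: le_trans (envelope_err_le _ _ _ n (ltW t0) _) _ => //.
  apply: le_trans (small (maxn N M0)); apply: ler_wpM2l => //; rewrite lerD2l.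
  apply: ler_sum => m _; rewrite ler_peMl//.
  by have [_ []] := g_weight.
have -> : 2 * C ^+ 2 * t = e / 2 * (C ^+ 2 / (C ^+ 2 + 1)).
  by rewrite /t; field; rewrite gt_eqF//; lra.
have : C ^+ 2 / (C ^+ 2 + 1) <= 1 by rewrite ler_pdivrMr; lra.
move=> /(ler_wpM2l (_ : 0 <= e / 2)); rewrite mulr1 => /(_ ltac:(lra)); lra.
Qed.

(** A point mass at [k - d] keeps its norm under the weight [lam ^+ zlen] centred there, and
    evaluating its image at [k] reads the envelope at [d]. The envelope depends on [e]; the bound on
    its weighted sums does not. *)
Lemma inv_diag_decay e : 0 < e -> exists A : Zc -> R, [/\ forall d, 0 <= A d,
  (forall r : seq Zc, uniq r -> \sum_(d <- r) g d * A d <= 2 * C * G) &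
  forall k d v, nrm (inv_diag k d v) <= (A d + e) * nrm v].
Proof.
move=> e0; have [n [M [t [NM tailM err_e]]]] := envelope_err_small e0.
have [gpos [_ gD _ _ _]] := g_weight.
pose w m := lam ^+ zlen (m : Zc).
exists (envelope beta C kap (cubeD M N) w n); split.
- by move=> d; apply: envelope_ge0 => // i; exact: lamX.
- apply: envelope_weighted_sum_le => // i; [exact: lamX|exact: ltW].
move=> k d v; rewrite mulrC.
have wl i m : w i <= lam ^+ zlen m * w (i - m).
  rewrite /w -exprD; apply: ler_weXn2l => //.
  by have := zlenD m (i - m); rewrite addrC subrK.
have dK : lp_le p (fun j => (w (j - (k - d)))%:C%C *: delta (k - d) v j) (nrm v).
  have := lp_le_delta (k - d) v p1; congr (lp_le _ _ _); apply/funext => j.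
  by rewrite /delta; case: eqP => [->|_]; rewrite ?scaler0// subrr /w zlen0 expr0 scale1r.
have := inverse_envelope _ wl NM tailN tailM n (nrm_ge0 v) dK k.
rewrite subKr => /(_ (fun i => lamX _))/le_trans; apply.
by apply: ler_wpM2l; [exact: nrm_ge0|rewrite lerD2l].
Qed.

(** The weight [lam ^+ (n - zlen i)] centred at [k] equals 1 wherever the truncated family can be
    nonzero, so the weighted norm stays below [K] for all [n], while the envelope at 0 tends to
    0. *)
Lemma inverse_off_cube x k e : in_lp p x -> 0 < e -> exists L, forall n, (L <= n)%N ->
  nrm (S (fun i => if k - i \in cube c n then 0 else x i) k) < e.
Proof.
move=> /(in_lpP _ p1)[K K0 xK] e0.
set e' := e / (2 * (K + 1)).
have e'0 : 0 < e' by rewrite divr_gt0//; lra.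
have [n0 [M [t [NM tailM err_e]]]] := envelope_err_small e'0.
pose w n m := lam ^+ (n - zlen (m : Zc))%N.
have wl n i m : w n i <= lam ^+ zlen m * w n (i - m).
  rewrite /w -exprD; apply: ler_weXn2l => //.
  by have := zlenD i (- m); rewrite zlenN; lia.
have w0 d : (fun n => (w n d)^-1) @ \oo --> (0 : R).
  rewrite -(cvg_shiftn (zlen d)) (_ : (fun n => _) = geometric 1 lam^-1).
    apply: cvg_geometric; rewrite ger0_norm ?invr_ge0 ?(le_trans ler01 lam1)//.
    by rewrite invf_lt1 ?(lt_le_trans ltr01 lam1)// exprn_egt1.
  by apply/funext => n; rewrite /w addnK /geometric/= mul1r exprVn.
have /cvgrPdist_lt/(_ _ e'0)[L _ HL] :=
  @envelope_cvg0 _ _ beta C kap (cubeD M N) w n0 w0 0.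
exists L => n /HL /=; rewrite sub0r normrN => /(le_lt_trans (ler_norm _)) env_e.
set y := fun i => _.
have yK : lp_le p (fun i => (w n (i - k))%:C%C *: y i) K.
  rewrite -[K]mul1r; apply: lp_le_dom xK => // i; rewrite /y mul1r.
  case: ifPn => [_|kin]; first by rewrite scaler0 nrm0 nrm_ge0.
  (* Outside the cube of radius [n] around [k] the l1-distance to [k] is at least [n], so the
     truncated subtraction gives 0. *)
  rewrite /w (_ : (n - _)%N = 0%N) ?expr0 ?scale1r//.
  apply/eqP; rewrite subn_eq0 -zlenN opprB leqNgt; apply: contra kin => lt_n.
  by apply: cube_le (cube_zlen _); exact: ltnW.
have := inverse_envelope _ (wl n) NM tailN tailM n0 K0 yK k.
rewrite subrr => /(_ (fun i => lamX _))/le_lt_trans; apply.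
apply: (@le_lt_trans _ _ (K * (e' + e'))).
  by apply: ler_wpM2l => //; apply: lerD => //; exact: ltW.
rewrite (_ : K * (e' + e') = e * (K / (K + 1))); last first.
  by rewrite /e'; field; rewrite gt_eqF//; lra.
by rewrite gtr_pMr// ltr_pdivrMr; lra.
Qed.

(** By linearity, [S x k] minus the sum over [cube c n] is the value at [k] of [S] applied to [x]
    with that cube around [k] removed. *)
Lemma inv_diag_repr x k : in_lp p x ->
  (fun n => \sum_(m <- cube c n) inv_diag k m (x (k - m))) @ \oo --> S x k.
Proof.
move=> xp; apply/nrm_cvgP => e e0; have [L HL] := inverse_off_cube k xp e0.
exists L => n /HL; congr (nrm _ < _).
rewrite /inv_diag -(@op_sum _ _ (fun m => delta (k - m) (x (k - m)))); last first.
  by move=> m; exact: in_lp_delta.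
rewrite -opB//; last by apply: in_lp_sum => m; exact: in_lp_delta.
congr (S _ k); apply/funext => i; rewrite /delta; case: ifPn => [kin|kin].
  rewrite (bigD1_seq (k - i)) ?cube_uniq//= subKr eqxx big1 ?addr0 ?subrr// => m mk.
  by case: eqP => // im; move: mk; rewrite im subKr eqxx.
rewrite big_seq big1 ?subr0// => m mn; case: eqP => // im.
by move: kin; rewrite im subKr mn.
Qed.

(** The majorants [A d + e] of [inv_diag_decay] change with [e]; the least majorant of the diagonal
    lies below all of them. *)
Definition inv_beta (d : Zc) : R :=
  inf [set u | 0 <= u /\ forall k v, nrm (inv_diag k d v) <= u * nrm v].

Let inv_beta_has_inf d :
  has_inf [set u | 0 <= u /\ forall k v, nrm (inv_diag k d v) <= u * nrm v].
Proof.
split; last by exists 0 => u [].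
have [A [A0 _ HA]] := inv_diag_decay ltr01.
by exists (A d + 1); split=> [|k v]; [rewrite addr_ge0|exact: HA].
Qed.

Lemma inv_beta_ge0 d : 0 <= inv_beta d.
Proof. by apply: lb_le_inf => [|u []//]; case: (inv_beta_has_inf d). Qed.

Lemma inv_diag_le k d v : nrm (inv_diag k d v) <= inv_beta d * nrm v.
Proof.
have [v0|v0] := eqVneq (nrm v) 0.
  by have [[u [_ Hu]] _] := inv_beta_has_inf d; have := Hu k v; rewrite v0 !mulr0.
have {}v0 : 0 < nrm v by rewrite lt_def v0 nrm_ge0.
rewrite -ler_pdivrMr//; apply: lb_le_inf => [|u [_ Hu]].
  by case: (inv_beta_has_inf d).
by rewrite ler_pdivrMr.
Qed.

(** On a fixed finite list the additive error weighs [e'] times the sum of [g], which the choice of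
    [e'] keeps below [e]. *)
Lemma inv_beta_sum_le r : uniq r -> \sum_(d <- r) g d * inv_beta d <= 2 * C * G.
Proof.
move=> ur; have [gpos _] := g_weight.
have s0 : 0 <= \sum_(d <- r) g d by apply: sumr_ge0 => d _; exact: ltW.
apply/ler_addgt0Pr => e e0; set e' := e / (\sum_(d <- r) g d + 1).
have e'0 : 0 < e' by rewrite divr_gt0//; lra.
have [A [A0 gA HA]] := inv_diag_decay e'0.
apply: (@le_trans _ _ (\sum_(d <- r) (g d * A d + g d * e'))).
  apply: ler_sum => d _; rewrite -mulrDr; apply: ler_wpM2l; first exact: ltW.
  apply: ge_inf; first by case: (inv_beta_has_inf d).
  by split=> [|k v]; [rewrite addr_ge0// ltW|exact: HA].
rewrite big_split/= -mulr_suml; apply: lerD; first exact: gA.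
by rewrite /e' mulrCA ger_pMr// ler_pdivrMr; lra.
Qed.

Lemma inverse_matrix : exists (b' : Zc -> Zc -> X -> X) (beta' : Zc -> R),
  [/\ forall k m, linear (b' k m),
      forall k m v, nrm (b' k m v) <= beta' m * nrm v,
      forall m, 0 <= beta' m,
      forall r : seq Zc, uniq r -> \sum_(m <- r) g m * beta' m <= 2 * C * G &
      forall x, in_lp p x -> forall k,
        (fun n => \sum_(m <- cube c n) b' k m (x (k - m))) @ \oo --> S x k].
Proof.
exists inv_diag, inv_beta; split.
- exact: inv_diag_linear.
- exact: inv_diag_le.
- exact: inv_beta_ge0.
- exact: inv_beta_sum_le.
- by move=> x xp k; exact: inv_diag_repr.
Qed.

End Decay.

End Iteration.

(** * Choice of the constants and conclusion *)

Lemma exists_exp_near1 (R : realType) n (e : R) : 0 < e ->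
  exists2 mu, 1 < mu & mu ^+ n <= 1 + e.
Proof.
move=> e0; have e1 : 1 < 1 + e by lra.
exists ((1 + e) `^ n.+1%:R^-1).
  have := @gt0_ltr_powR R n.+1%:R^-1 _ 1 (1 + e).
  by rewrite invr_gt0 ltr0n !nnegrE powR1; apply; rewrite ?ler01//; lra.
rewrite -powR_mulrn ?powR_ge0// -powRrM -[leRHS]powRr1; last lra.
by apply: ler_powR; [lra|rewrite ler_pdivrMl// mulr1 ler_nat].
Qed.

Lemma lp_op_le (R : realType) (X : completeNormedModType R[i]) (c : nat)
  (p : \bar R) (S : ('rV[int]_c -> X) -> ('rV[int]_c -> X)) :
  (1%:E <= p)%E -> lp_op p S ->
  exists2 C : R, 0 <= C & forall x (K : R), 0 <= K -> lp_le p x K -> lp_le p (S x) (C * K).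
Proof.
move=> p1 [_ _ [M HM]]; exists `|M| => // x K K0 xK.
have xp : in_lp p x by apply/in_lpP => //; exists K.
apply/lpnorm_leP => //; first exact: mulr_ge0.
apply: le_trans (HM x xp) _; rewrite EFinM.
apply: (@le_trans _ _ (`|M|%:E * lpnorm p x)%E).
  by apply: lee_wpmul2r; [exact: lpnorm_ge0|rewrite lee_fin ler_norm].
by apply: lee_wpmul2l; [rewrite lee_fin|apply/lpnorm_leP].
Qed.

Unset Implicit Arguments.

Theorem mainTheorem7 (R : realType) (X : completeNormedModType R[i]) (c : nat)
  (p : \bar R) (g : 'rV[int]_c -> R) :
  (1%:E <= p)%E -> is_weight g ->
  forall T S : ('rV[int]_c -> X) -> ('rV[int]_c -> X),
    in_s1g p g T -> lp_inverse p T S -> in_s1g p g S.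
Proof.
move=> p1 gw T S [T_op [b [beta [b_lin b_le beta0 gbeta T_repr]]]] [S_op STK].
have [C C0 S_le] := lp_op_le p1 S_op.
have [T_lp _ _] := T_op.
have [_ S_lin _] := S_op.
have [gpos [_ _ _ g1 _]] := gw.
have gb0 m : 0 <= g m * beta m by rewrite mulr_ge0// ltW.
have /(esum_lt_pinftyP gb0)[K HK] := gbeta.
have T_cvg x : in_lp p x -> forall k,
    (fun N => \sum_(m <- cube c N) b k m (x (k - m))) @ \oo --> T x k.
  move=> xp k; have := T_repr x xp k; under eq_fun do rewrite (big_cube _ (fun m => b k m (x (k - m)))).
  by [].
have tailg := cube_tail_small gb0 HK.
have tail0 t : 0 < t -> exists N, tail_le beta N t.
  move=> /tailg[N HN]; exists N => r ur rN; apply: le_trans (HN r ur rN).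
  by apply: ler_sum => m _; rewrite ler_peMl.
(* Three quantities will be at most [e]: the conjugation error, the tail mass of [beta] and its
   g-weighted tail. Then [C * (3 * e) = C / (2 * (C + 1))], which is at most 1/2. *)
pose e := (6 * (C + 1))^-1.
have e0 : 0 < e by rewrite invr_gt0; lra.
have [N HN] := tailg e e0.
have tailN : tail_le beta N e.
  move=> r ur rN; apply: le_trans (HN r ur rN).
  by apply: ler_sum => m _; rewrite ler_peMl.
pose B := \sum_(m <- cube c N) beta m.
have B0 : 0 <= B by exact: sumr_ge0.
(* With [N] fixed, [zlen m <= c * N] on the cube, so this [mu] makes every [(mu ^+ 2) ^+ zlen m - 1]
   there at most [e / (B + 1)]. *)
have [mu mu1 muN] : exists2 mu : R, 1 < mu & mu ^+ (2 * (c * N)) <= 1 + e / (B + 1).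
  by apply: exists_exp_near1; rewrite divr_gt0//; lra.
have [G G0 HG] := weight_summable gw mu1.
have head_le : \sum_(m <- cube c N) beta m * ((mu ^+ 2) ^+ zlen m - 1) <= e.
  apply: (@le_trans _ _ (B * (e / (B + 1)))); last first.
    by rewrite mulrCA ger_pMr// ler_pdivrMr; lra.
  rewrite mulr_suml big_seq [leRHS]big_seq; apply: ler_sum => m mN.
  apply: ler_wpM2l => //; rewrite lerBlDl; apply: le_trans muN.
  rewrite -exprM; apply: ler_weXn2l; first exact: ltW.
  by rewrite leq_mul2l zlen_cube.
have small M : C * (\sum_(m <- cube c N) beta m * ((mu ^+ 2) ^+ zlen m - 1) + e +
    \sum_(m <- cubeD c M N) g m * beta m) <= 2^-1.
  have tM : \sum_(m <- cubeD c M N) g m * beta m <= e.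
    by apply: HN => [|m]; [exact: cubeD_uniq|exact: cubeD_notin].
  apply: (@le_trans _ _ (C * (3 * e))); first by apply: ler_wpM2l => //; lra.
  rewrite (_ : C * (3 * e) = 2^-1 * (C / (C + 1))); last first.
    by rewrite /e; field; rewrite gt_eqF//; lra.
  by rewrite ger_pMr// ler_pdivrMr; lra.
have [b' [beta' [b'_lin b'_le beta'0 gbeta' b'_repr]]] := inverse_matrix
  p1 beta0 C0 b_lin b_le T_cvg T_lp S_lin S_le STK gw mu1 tailN small tail0 HG.
split=> //; exists b', beta'; split=> //.
  apply/esum_lt_pinftyP => [m|]; first by rewrite mulr_ge0// ltW.
  by exists (2 * C * G).
move=> x xp k.
under eq_fun do rewrite (big_cube _ (fun m => b' k m (x (k - m)))).
exact: b'_repr.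
Qed.
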